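(* Let $1\le k\le n$, let $D\in\mathbb{R}^{n\times k}$, and let $\phi,\psi:\mathbb{R}^{n\times k}\to\mathbb{R}$ be continuously differentiable and unitarily invariant, with $\psi(X)>0$ for all $X\in\mathbb{O}^{n\times k}$. Let $X_*\in\mathbb{O}^{n\times k}$ be a global maximizer of $$\max_{X\in\mathbb{O}^{n\times k}} f(X),\qquad f(X):=\phi(X)+\psi(X)\cdot\operatorname{tr}(X^{T}D).$$ Then $X_*^{T}D\succeq 0$ and $\operatorname{rank}(X_*^{T}D)=\operatorname{rank}(D)$.
   Context: $\mathbb{O}^{n\times k}:=\{X\in\mathbb{R}^{n\times k}: X^{T}X=I_k\}$ is the Stiefel manifold. A function $F$ on $\mathbb{R}^{n\times k}$ is unitarily invariant if $F(XQ)=F(X)$ for all $X\in\mathbb{R}^{n\times k}$ and $Q\in\mathbb{O}^{k\times k}$. $A\succeq 0$ means that $A$ is symmetric and positive semidefinite. *)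

(* Defs.v *)
From HB Require Import structures.
From mathcomp Require Import all_boot all_order all_algebra.
From mathcomp Require Import all_classical all_reals all_analysis.

Set Implicit Arguments.
Unset Strict Implicit.
Unset Printing Implicit Defensive.

Import Order.TTheory GRing.Theory Num.Theory.
Import numFieldNormedType.Exports.

Local Open Scope classical_set_scope.
Local Open Scope ring_scope.

(* For n = k this is the orthogonal group. *)
Definition stiefel (R : realType) (n k : nat) : set 'M[R]_(n, k) :=
  [set X | X^T *m X = 1%:M].

Definition unitarily_invariant (R : realType) (n k : nat)
    (F : 'M[R]_(n, k) -> R) : Prop :=
  forall (X : 'M[R]_(n, k)) (Q : 'M[R]_k), stiefel Q -> F (X *m Q) = F X.

(* Entry (i, j) is the partial derivative with respect to the (i, j) entry. *)
Definition gradient (R : realType) (n k : nat)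
    (F : 'M[R]_(n, k) -> R) (X : 'M[R]_(n, k)) : 'M[R]_(n, k) :=
  \matrix_(i, j) 'd F X (delta_mx i j).

Definition continuously_differentiable (R : realType) (n k : nat)
    (F : 'M[R]_(n, k) -> R) : Prop :=
  (forall X, differentiable F X) /\ continuous (gradient F).

Definition possemidef (R : realType) (k : nat) (A : 'M[R]_k) : Prop :=
  A^T = A /\ forall x : 'cV[R]_k, 0 <= (x^T *m A *m x) 0 0.

Definition global_maximizer (R : realType) (T : Type)
    (S : set T) (f : T -> R) (x : T) : Prop :=
  S x /\ forall y, S y -> f y <= f x.

(* Main.v *)
Require Import Defs.
From HB Require Import structures.
From mathcomp Require Import all_boot all_order all_algebra.
From mathcomp Require Import all_classical all_reals all_analysis.
From mathcomp Require Import ring lra.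

Import Order.TTheory GRing.Theory Num.Theory.
Import numFieldNormedType.Exports.

Local Open Scope classical_set_scope.
Local Open Scope ring_scope.

(* Put X := X_*. By unitary invariance, f(XQ) <= f(X) reads
   tr(Q^T X^T D) <= tr(X^T D) for all orthogonal Q; taking for Q a reflection,
   resp. a product of two reflections, makes X^T D positive semidefinite, resp.
   symmetric. For the rank, let v be a unit vector with X^T D v = 0 and suppose
   D v <> 0. Put w := D v / |D v|, which is orthogonal to the columns of X, and let
   Y(t) be X with Xv rotated to (cos t) Xv + (sin t) w. Replacing Y(t) by
   Y(t) (I - 2 v v^T) keeps phi and psi but turns tr(Y(t)^T D) =
   tr(X^T D) + |D v| sin t into tr(X^T D) - |D v| sin t. Both resulting functions of
   t are maximal at t = 0, so both derivatives vanish there; their difference gives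
   psi(X) |D v| = 0, a contradiction. *)

Lemma mulmx_outer {R : realType} {m n p : nat} (a : 'cV[R]_m) (b c : 'cV[R]_n)
    (d : 'cV[R]_p) :
  (a *m b^T) *m (c *m d^T) = (b^T *m c) 0 0 *: (a *m d^T).
Proof.
by rewrite mulmxA -(mulmxA a) {1}[b^T *m c]mx11_scalar mul_mx_scalar -scalemxAl.
Qed.

Lemma mxtrace_outer {R : realType} {m n : nat} (a : 'cV[R]_m) (b : 'cV[R]_n)
    (A : 'M[R]_(n, m)) : \tr ((a *m b^T) *m A) = (b^T *m A *m a) 0 0.
Proof. by rewrite -mulmxA mxtrace_mulC trace_mx11. Qed.

Lemma sqnorm_sum {R : realType} {n : nat} (v : 'cV[R]_n) :
  (v^T *m v) 0 0 = \sum_i v i 0 ^+ 2.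
Proof. by rewrite mxE; apply: eq_bigr => i _; rewrite mxE expr2. Qed.

Lemma sqnorm_gt0 {R : realType} {n : nat} (v : 'cV[R]_n) :
  v != 0 -> 0 < (v^T *m v) 0 0.
Proof.
move=> v0; rewrite sqnorm_sum lt_neqAle sumr_ge0 ?andbT; last first.
  by move=> i _; exact: sqr_ge0.
apply: contra v0 => /eqP/esym/eqP.
rewrite psumr_eq0; last by move=> i _; exact: sqr_ge0.
move=> /allP h; apply/eqP/matrixP => i j; rewrite mxE ord1.
by have /implyP/(_ isT) := h i (mem_index_enum i); rewrite sqrf_eq0 => /eqP.
Qed.

Lemma exists_unit_multiple {R : realType} {n : nat} (v : 'cV[R]_n) : v != 0 ->
  exists2 a : R, 0 < a & ((a *: v)^T *m (a *: v)) 0 0 = 1.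
Proof.
move=> /sqnorm_gt0 v0; have s0 : 0 < Num.sqrt ((v^T *m v) 0 0) by rewrite sqrtr_gt0.
exists (Num.sqrt ((v^T *m v) 0 0))^-1; first by rewrite invr_gt0.
rewrite [(_ *: v)^T]linearZ /= -scalemxAl -scalemxAr scalerA mxE.
by rewrite -{3}(sqr_sqrtr (ltW v0)); field; exact: lt0r_neq0.
Qed.

Lemma stiefel_mul {R : realType} {n k : nat} (X : 'M[R]_(n, k)) (Q : 'M[R]_k) :
  stiefel X -> stiefel Q -> stiefel (X *m Q).
Proof.
rewrite /stiefel /= => hX hQ.
by rewrite trmx_mul mulmxA -(mulmxA Q^T) hX mulmx1.
Qed.

(** In the Gram matrix of [X + z *m v^T] the two cross terms and the square term are [a], [a] and
    [- (2 * a)] times [v *m v^T], so they cancel. This serves both the reflections and the rotated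
    curve in [maximizer_kernel]. *)
Lemma stiefel_rank1_update {R : realType} {n k : nat} (X : 'M[R]_(n, k))
    (z : 'cV[R]_n) (v : 'cV[R]_k) (a : R) :
  stiefel X -> X^T *m z = a *: v -> (z^T *m z) 0 0 = - (2 * a) ->
  stiefel (X + z *m v^T).
Proof.
rewrite /stiefel /= => hX Xz zz.
have zX : z^T *m X = a *: v^T by rewrite -[LHS]trmxK trmx_mul trmxK Xz linearZ.
rewrite [(_ + _)^T]linearD /= trmx_mul trmxK mulmxDl !mulmxDr hX mulmxA Xz mulmx_outer zz.
rewrite -mulmxA zX -scalemxAl -scalemxAr -addrA -!scalerDl.
suff -> : a + (a - 2 * a) = 0 by rewrite scale0r addr0.
by ring.
Qed.

(* At [v = 0] division by zero makes this the identity, still orthogonal. *)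
Definition householder {R : realType} {k : nat} (v : 'cV[R]_k) : 'M[R]_k :=
  1%:M - (2 / (v^T *m v) 0 0) *: (v *m v^T).

Lemma householder_sym {R : realType} {k : nat} (v : 'cV[R]_k) :
  (householder v)^T = householder v.
Proof. by rewrite /householder linearB linearZ /= trmx1 trmx_mul trmxK. Qed.

Lemma householder_stiefel {R : realType} {k : nat} (v : 'cV[R]_k) :
  stiefel (householder v).
Proof.
have -> : householder v = 1%:M + (- (2 / (v^T *m v) 0 0) *: v) *m v^T.
  by rewrite /householder -scalemxAl scaleNr.
apply: (stiefel_rank1_update _ _ _ (- (2 / (v^T *m v) 0 0))).
- by rewrite /stiefel /= trmx1 mulmx1.
- by rewrite trmx1 mul1mx.
rewrite [(_ *: _)^T]linearZ /= -scalemxAl -scalemxAr scalerA mxE.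
(* If [v^T *m v] is zero, so is its inverse, and both sides vanish. *)
by have [->|b0] := eqVneq ((v^T *m v) 0 0) 0; [rewrite invr0; ring|field].
Qed.

(** A product of two reflections is a rotation. In the plane of coordinates [i] and [j], its
    first-order effect on the trace is proportional to [A i j - A j i], which must vanish at a
    maximum. *)
Lemma max_trace_sym {R : realType} {k : nat} (A : 'M[R]_k) :
  (forall Q : 'M[R]_k, stiefel Q -> \tr (Q^T *m A) <= \tr A) -> A^T = A.
Proof.
move=> hA; apply/matrixP => i j; rewrite mxE.
have [->//|neq_ij] := eqVneq i j.
(* The bound below comes from [Q = H_v H_u] with [u = e_i] and [v = e_i + t e_j]. *)
suff h t : 0 <= t * (A i j - A j i) + t ^+ 2 * (A i i + A j j).
  set b := A i j - A j i in h; set c := A i i + A j j in h.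
  (* Testing the bound at t = -b / (1 + |c|) gives, up to a positive factor, b^2 (c - 1 - |c|) >= 0,
     where the second factor is at most -1. *)
  have M0 : 0 < 1 + `|c| by rewrite ltr_pwDl.
  have : 0 <= (1 + `|c|) ^+ 2 * (- b / (1 + `|c|) * b + (- b / (1 + `|c|)) ^+ 2 * c).
    by rewrite mulr_ge0 ?h ?sqr_ge0.
  have -> : (1 + `|c|) ^+ 2 * (- b / (1 + `|c|) * b + (- b / (1 + `|c|)) ^+ 2 * c) =
     b ^+ 2 * (c - (1 + `|c|)) by field; exact: lt0r_neq0.
  have := ler_norm c; rewrite /b => cle hb.
  have : (A i j - A j i) ^+ 2 <= 0 by nra.
  by rewrite le_eqVlt ltNge sqr_ge0 orbF sqrf_eq0 subr_eq0 => /eqP.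
pose u : 'cV[R]_k := delta_mx i 0.
pose v : 'cV[R]_k := delta_mx i 0 + t *: delta_mx j 0.
have du l m : ((delta_mx l 0 : 'cV[R]_k)^T *m A *m (delta_mx m 0 : 'cV[R]_k)) 0 0 = A l m.
  by rewrite trmx_delta -rowE -colE !mxE.
have dd l m : ((delta_mx l 0 : 'cV[R]_k)^T *m (delta_mx m 0 : 'cV[R]_k)) 0 0 = (l == m)%:R.
  by rewrite trmx_delta -rowE !mxE eqxx andbT.
have vT : v^T = (delta_mx i 0)^T + t *: (delta_mx j 0)^T by rewrite linearD linearZ.
have nji : (j == i) = false by rewrite eq_sym (negbTE neq_ij).
have uu : (u^T *m u) 0 0 = 1 by rewrite dd eqxx.
have uv : (u^T *m v) 0 0 = 1.
  by rewrite /v mulmxDr -scalemxAr mxE [X in _ + X]mxE !dd eqxx (negbTE neq_ij) mulr0 addr0.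
have vv : (v^T *m v) 0 0 = 1 + t ^+ 2.
  rewrite vT mulmxDl mxE uv -scalemxAl [X in _ + X]mxE mulmxDr -scalemxAr mxE.
  by rewrite [X in t * (_ + X)]mxE !dd eqxx nji /=; ring.
have uAu : (u^T *m A *m u) 0 0 = A i i by rewrite du.
have vAu : (v^T *m A *m u) 0 0 = A i i + t * A j i.
  by rewrite vT !mulmxDl -!scalemxAl mxE [X in _ + X]mxE !du.
have vAv : (v^T *m A *m v) 0 0 = A i i + t * A j i + t * (A i j + t * A j j).
  rewrite [in LHS]/v mulmxDr mxE vAu -scalemxAr [X in _ + X]mxE vT !mulmxDl -!scalemxAl.
  by rewrite mxE [X in t * (_ + X)]mxE !du.
have := hA _ (stiefel_mul _ _ (householder_stiefel v) (householder_stiefel u)).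
rewrite trmx_mul !householder_sym /householder uu vv.
rewrite mulmxBl mul1mx mulmxBr mulmx1 -scalemxAl -scalemxAr mulmx_outer uv.
rewrite scale1r !mulmxBl mul1mx -!scalemxAl !(raddfB, raddfN) /= !mxtraceZ divr1.
rewrite !mxtrace_outer uAu vAu vAv.
have t0 : 0 < 1 + t ^+ 2 by rewrite ltr_pwDl// sqr_ge0.
(* The factor [(1 + t ^+ 2) / 2] clears the denominator that comes from normalizing [v]. *)
move=> H; have : 0 <= (1 + t ^+ 2) / 2 * (2 / (1 + t ^+ 2) *
    (A i i + t * A j i + t * (A i j + t * A j j)) + 2 * A i i -
    2 * (2 / (1 + t ^+ 2) * (A i i + t * A j i))).
  by rewrite mulr_ge0 ?divr_ge0 ?(ltW t0)//; lra.
set L := (X in 0 <= X -> _); suff -> : L = t * (A i j - A j i) + t ^+ 2 * (A i i + A j j) by [].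
by rewrite /L; field; exact: lt0r_neq0.
Qed.

(** For [v != 0], the reflection along [v] lowers the trace by a positive multiple of the quadratic
    form of [A] at [v]. *)
Lemma max_trace_ge0 {R : realType} {k : nat} (A : 'M[R]_k) (v : 'cV[R]_k) :
  (forall Q : 'M[R]_k, stiefel Q -> \tr (Q^T *m A) <= \tr A) ->
  0 <= (v^T *m A *m v) 0 0.
Proof.
move=> hA; have [->|v0] := eqVneq v 0; first by rewrite mulmx0 mxE.
have := hA _ (householder_stiefel v).
rewrite householder_sym /householder mulmxBl mul1mx -scalemxAl raddfB /= mxtraceZ.
by rewrite mxtrace_outer gerBl pmulr_rge0// divr_gt0 ?sqnorm_gt0.
Qed.

Lemma maximizer_kernel {R : realType} {n k : nat} (D : 'M[R]_(n, k))
    (phi psi : 'M[R]_(n, k) -> R) (X : 'M[R]_(n, k)) :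
  (forall Y, differentiable phi Y) -> (forall Y, differentiable psi Y) ->
  unitarily_invariant phi -> unitarily_invariant psi -> 0 < psi X ->
  global_maximizer (@stiefel R n k)
    (fun Y => phi Y + psi Y * \tr (Y^T *m D)) X ->
  forall v : 'cV[R]_k, X^T *m (D *m v) = 0 -> D *m v = 0.
Proof.
move=> dphi dpsi phiI psiI psiX [hX hmax] v0 XDv0.
apply/eqP/negP => /negP Dv0.
have v0N : v0 != 0 by apply: contra Dv0 => /eqP->; rewrite mulmx0.
have [a a0] := exists_unit_multiple _ v0N; set v := a *: v0 => vv.
have XDv : X^T *m (D *m v) = 0 by rewrite -!scalemxAr XDv0 scaler0.
have {v0N XDv0} DvN : D *m v != 0 by rewrite -scalemxAr scaler_eq0 negb_or lt0r_neq0.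
clearbody v.
have [b b0] := exists_unit_multiple _ DvN; set w := b *: (D *m v) => ww.
have Xw : X^T *m w = 0 by rewrite -scalemxAr XDv scaler0.
have wX : w^T *m X = 0 by rewrite -[LHS]trmxK trmx_mul trmxK Xw trmx0.
have vXDv : v^T *m X^T *m D *m v = 0 by rewrite -!mulmxA XDv mulmx0.
(* Since [w] is [D *m v] normalized, [d] is the norm of [D *m v]. *)
set d := (w^T *m D *m v) 0 0.
have d0 : 0 < d.
  by rewrite /d -mulmxA [w^T]linearZ -scalemxAl mxE mulr_gt0// sqnorm_gt0.
clearbody w.
(* As [v] is a unit vector, adding [z t *m v^T] sends [v] to the rotated vector and leaves the
   action of [X] on the complement of [v] unchanged. The squared norm of [z t] is 2 - 2 cos t, as
   the rank-one update requires. *)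
pose z (t : R) := (cos t - 1) *: (X *m v) + sin t *: w.
pose Y (t : R) := X + z t *m v^T.
have YS t : stiefel (Y t).
  apply: (stiefel_rank1_update _ _ _ (cos t - 1)) => //.
    by rewrite mulmxDr -!scalemxAr Xw scaler0 addr0 mulmxA hX mul1mx.
  rewrite /z [(_ + _)^T]linearD /= ![(_ *: _)^T]linearZ /= trmx_mul.
  rewrite mulmxDl -!scalemxAl !mulmxDr -!scalemxAr.
  rewrite -(mulmxA v^T) (mulmxA X^T X) hX mul1mx -(mulmxA v^T) Xw (mulmxA w^T) wX.
  rewrite mul0mx mulmx0 !scaler0 addr0 add0r [v^T *m v]mx11_scalar [w^T *m w]mx11_scalar vv ww !mxE eqxx /=.
  by have := cos2Dsin2 t; lra.
have zDv t : ((z t)^T *m D *m v) 0 0 = sin t * d.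
  rewrite /z [(_ + _)^T]linearD /= ![(_ *: _)^T]linearZ /= trmx_mul.
  by rewrite !mulmxDl -!scalemxAl vXDv scaler0 add0r mxE.
have trY t : \tr ((Y t)^T *m D) = \tr (X^T *m D) + sin t * d.
  rewrite /Y [(_ + _)^T]linearD /= trmx_mul trmxK mulmxDl mxtraceD.
  rewrite -mulmxA [\tr (v *m _)]mxtrace_mulC trace_mx11.
  by rewrite zDv.
(* The reflection turns [sin t] into [- sin t], since [v^T X^T D v = 0]. *)
have trYH t : \tr ((Y t *m householder v)^T *m D) = \tr (X^T *m D) - sin t * d.
  rewrite trmx_mul householder_sym /householder vv divr1 -mulmxA mulmxBl mul1mx.
  rewrite mxtraceD trY -scalemxAl raddfN /= mxtraceZ mxtrace_outer.
  rewrite /Y [(_ + _)^T]linearD /= trmx_mul trmxK mulmxDl mulmxDr mulmxDl mxE.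
  rewrite !mulmxA vXDv mxE add0r [v^T *m v]mx11_scalar vv.
  rewrite mul1mx zDv.
  by ring.
have Y0 : Y 0 = X by rewrite /Y /z cos0 sin0 subrr !scale0r addr0 mul0mx addr0.
have dcos t : differentiable (@cos R) t by apply/derivable1_diffP/derivable_cos.
have dsin t : differentiable (@sin R) t by apply/derivable1_diffP/derivable_sin.
have dY t : differentiable Y t.
  have -> : Y = (fun s => X + (cos s - 1) *: (X *m v *m v^T) + sin s *: (w *m v^T)).
    by apply/funext => s; rewrite /Y /z mulmxDl -!scalemxAl addrA.
  apply: differentiableD; last exact: differentiableZl.
  apply: differentiableD; first exact: differentiable_cst.
  apply: differentiableZl; apply: differentiableB => //.
have dphiY t : derivable (phi \o Y) t 1.
  by apply/derivable1_diffP/differentiable_comp.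
have dpsiY t : derivable (psi \o Y) t 1.
  by apply/derivable1_diffP/differentiable_comp.
(* By unitary invariance, [e = 1] gives the objective along [Y] and [e = -1] the objective along the
   reflected curve. *)
pose F (e : R) : R -> R :=
  (phi \o Y) + (psi \o Y) * (cst (\tr (X^T *m D)) + (e * d) \*: @sin R).
have FE (e t : R) : F e t = phi (Y t) + psi (Y t) * (\tr (X^T *m D) + e * (sin t * d)).
  by rewrite /F !fctE /= /GRing.scale /=; ring.
have dF (e t : R) : derivable (F e) t 1 by apply: derivableD => //; exact: derivableM.
have F0 (e : R) : F e 0 = phi X + psi X * \tr (X^T *m D).
  by rewrite FE Y0 sin0 mul0r mulr0 addr0.
have Fmax (e : R) : e = 1 \/ e = -1 -> forall t, F e t <= F e 0.
  rewrite F0 => + t; case=> ->.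
    by have := hmax _ (YS t); rewrite trY FE mul1r.
  have := hmax _ (stiefel_mul _ _ (YS t) (householder_stiefel v)).
  by rewrite trYH FE phiI ?psiI ?mulN1r; [|exact: householder_stiefel..].
have F'0 (e : R) : e = 1 \/ e = -1 -> is_derive (0 : R) 1 (F e) 0.
  (* Any open interval around 0 would do, as the maximum is global. *)
  move=> e1; apply: (@derive1_at_max _ _ (-1) 1) => //.
  - by rewrite in_itv /= ltrN10 ltr01.
  - by move=> t _; exact: Fmax.
have Fdiff : (F 1 - F (-1)) = (psi \o Y) * ((2 * d) \*: @sin R).
  by apply/funext => t; rewrite !fctE !FE /= /GRing.scale /=; ring.
have h1 : is_derive (0 : R) 1 (F 1 - F (-1)) (0 - 0).
  by apply: is_deriveB; apply: F'0; [left|right].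
(* In the product rule the unknown derivative of [psi \o Y] is multiplied by sin 0 = 0. *)
have h2 : is_derive (0 : R) 1 (F 1 - F (-1)) (psi X * (2 * d)).
  rewrite Fdiff.
  have dp := DeriveDef (dpsiY 0) erefl.
  have := is_deriveM dp (is_deriveZ (2 * d) (is_derive_sin 0)).
  rewrite /= Y0 sin0 cos0 => H; apply: is_derive_eq H _.
  by rewrite !scaler0 scale0r addr0 scaler1.
have [_ e2] := h2; have [_ e1] := h1.
have : psi X * (2 * d) = 0 by rewrite -e2 e1 subrr.
by move/eqP; rewrite gt_eqF// mulr_gt0// mulr_gt0.
Qed.

Theorem theorem3p1 (R : realType) (n k : nat) (hk : (1 <= k <= n)%N)
    (D : 'M[R]_(n, k)) (phi psi : 'M[R]_(n, k) -> R)
    (phi_C1 : continuously_differentiable phi)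
    (phi_inv : unitarily_invariant phi)
    (psi_C1 : continuously_differentiable psi)
    (psi_inv : unitarily_invariant psi)
    (psi_gt0 : forall X : 'M[R]_(n, k), stiefel X -> 0 < psi X)
    (Xs : 'M[R]_(n, k))
    (Xs_max : global_maximizer (@stiefel R n k)
                (fun X => phi X + psi X * \tr (X^T *m D)) Xs) :
  possemidef (Xs^T *m D) /\ \rank (Xs^T *m D) = \rank D.
Proof.
have [hX hmax] := Xs_max.
have htr (Q : 'M[R]_k) : stiefel Q -> \tr (Q^T *m (Xs^T *m D)) <= \tr (Xs^T *m D).
  move=> hQ; have := hmax _ (stiefel_mul _ _ hX hQ).
  by rewrite phi_inv// psi_inv// lerD2l ler_pM2l ?psi_gt0// trmx_mul mulmxA.
split.
  by split; [exact: max_trace_sym | move=> v; exact: max_trace_ge0].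
(* Kernels here act on rows, hence the transposes: the rank lost from [D^T] to [D^T *m Xs] is that
   of the row space of [D^T] met with [kermx Xs]. A row [u *m D^T] in it is zero by
   [maximizer_kernel] at [u^T]. *)
rewrite -mxrank_tr trmx_mul trmxK -[RHS]mxrank_tr -(mxrank_mul_ker D^T Xs).
suff -> : (D^T :&: kermx Xs)%MS = 0 by rewrite mxrank0 addn0.
apply/eqP/rowV0P => r; rewrite sub_capmx => /andP[/submxP[u ->]] /sub_kermxP uDX.
have := @maximizer_kernel _ _ _ _ _ _ _ phi_C1.1 psi_C1.1 phi_inv psi_inv
  (psi_gt0 _ hX) Xs_max u^T.
move=> h; apply: trmx_inj; rewrite trmx_mul trmxK trmx0; apply: h.
by apply: trmx_inj; rewrite !trmx_mul !trmxK trmx0.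
Qed.
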